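(* Let $G\in\mathbb F_8^{m\times n}$ be a full-rank matrix with entries $g_{a,i}$ and with $k$ logical rows ($1\le k\le m$), and let $\boldsymbol\Gamma=(\Gamma_1,\dots,\Gamma_n)\in\mathbb F_8^n$ and $\boldsymbol\tau=(\tau_1,\dots,\tau_k)\in\mathbb F_8^k$ be such that for all $a,b,c\in\{1,\dots,m\}$ $$\sum_{i=1}^n \Gamma_i\,(g_{a,i})^4(g_{b,i})^2(g_{c,i})=\begin{cases}\tau_a & \text{if }1\le a=b=c\le k,\\ 0&\text{otherwise.}\end{cases}$$ Then for every $\beta\in\mathbb F_8$, on the quantum code over $\mathbb F_8$ defined by $G$, the physical gate $\bigotimes_{i=1}^n U_7^{\beta\Gamma_i}$ implements the logical gate $\overline{\bigotimes_{a=1}^k U_7^{\beta\tau_a}}$; that is, for all $u\in\mathbb F_8^k$, $$\Big(\bigotimes_{i=1}^n U_7^{\beta\Gamma_i}\Big)|\overline u\rangle=(-1)^{\mathrm{tr}\left(\beta\sum_{a=1}^k\tau_a u_a^7\right)}|\overline u\rangle .$$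
   Context: $\mathrm{tr}$ is the trace $\mathbb F_8\to\mathbb F_2$, $\mathrm{tr}(\gamma)=\gamma+\gamma^2+\gamma^4$. An $\mathbb F_8$-qudit has orthonormal basis $\{|\gamma\rangle:\gamma\in\mathbb F_8\}$. For $\beta\in\mathbb F_8$ the gate $U_7^\beta$ is $U_7^\beta|\gamma\rangle=(-1)^{\mathrm{tr}(\beta\gamma^7)}|\gamma\rangle$. A full-rank matrix $G\in\mathbb F_8^{m\times n}$ with rows $\mathbf g_1,\dots,\mathbf g_m$ and $k$ logical rows defines a CSS code on $n$ qudits: the first $k$ rows are $X$-logical operators, the last $m-k$ rows generate the $X$-stabilizer space $\mathcal G_0$, and the $Z$-stabilizers are the orthogonal complement (for $\langle x,y\rangle=\sum x_iy_i$) of the full row space. The (unnormalized) logical basis states are $|\overline u\rangle=\sum_{\mathbf g\in\mathcal G_0}\left|\sum_{a=1}^k u_a\mathbf g_a+\mathbf g\right\rangle$ for $u\in\mathbb F_8^k$. *)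

(* Defs.v *)
(* Built on Mathematical Components. *)
From HB Require Import structures.
From mathcomp Require Import all_boot all_order all_algebra all_field.
From mathcomp Require Import reals complex.

Set Implicit Arguments.
Unset Strict Implicit.
Unset Printing Implicit Defensive.

Import GRing.Theory.
Local Open Scope ring_scope.
Local Open Scope complex_scope.

(* The field of eight elements is any [F : finFieldType] with [#|F| = 8]. *)

(* The trace to the prime field, kept as an element of [F]: by [tr8_01] it is
   [0] or [1]. *)
Definition tr8 (F : finFieldType) (x : F) : F := x + x ^+ 2 + x ^+ 4.

Lemma tr8_01 (F : finFieldType) (x : F) :
  #|F| = 8%N -> (tr8 x == 0) || (tr8 x == 1).
Proof.
move=> F8.
have pF : 2%N \in [pchar F] by apply: (@card_finPcharP F 2%N 3%N).
have sq (y z : F) : (y + z) ^+ 2 = y ^+ 2 + z ^+ 2.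
  by rewrite sqrrD -mulr_natr (pcharf0 pF) mulr0 addr0.
have trK : tr8 x ^+ 2 = tr8 x.
  have x8 : x ^+ 8 = x by rewrite -F8 expf_card.
  by rewrite /tr8 !sq -!exprM [(2 * 2)%N]/= [(4 * 2)%N]/= x8 addrC addrA.
have : tr8 x * (tr8 x - 1) = 0 by rewrite mulrBr mulr1 -expr2 trK subrr.
by move/eqP; rewrite mulf_eq0 subr_eq0.
Qed.

Section Qudits.
Variables (R : realType) (F : finFieldType).
Local Notation C := R[i].

(* [(-1)^(tr x)] *)
Definition trsign (x : F) : C := (-1) ^+ (tr8 x == 1).

(* Vectors and operators of the complex space with basis indexed by [T]:
   [F] for one qudit, ['rV[F]_n] for [n] qudits.  An operator [A] is given by
   its entries [A x y = <x|A|y>]. *)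
Definition state (T : finType) := {ffun T -> C^o}.
Definition op (T : finType) := T -> T -> C.

Definition ket (T : finType) (x : T) : state T := [ffun y => (y == x)%:R].

Definition apply (T : finType) (A : op T) (psi : state T) : state T :=
  [ffun x => \sum_(y : T) A x y * psi y].

Definition tensor (n : nat) (A : 'I_n -> op F) : op 'rV[F]_n :=
  fun x y => \prod_(i < n) A i (x 0 i) (y 0 i).

Definition U7 (beta : F) : op F :=
  fun x y => if x == y then trsign (beta * y ^+ 7) else 0.

Lemma U7_ket (beta x : F) :
  apply (U7 beta) (ket x) = trsign (beta * x ^+ 7) *: ket x.
Proof.
apply/ffunP => z; rewrite !ffunE (bigD1 x) //= big1 => [|y yx].
  rewrite addr0 !ffunE eqxx mulr1 /U7.
  by case: (z == x); rewrite /GRing.scale /= ?mulr1 ?mulr0.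
by rewrite ffunE (negbTE yx) mulr0.
Qed.

Lemma tensor_ket (n : nat) (A : 'I_n -> op F) (y x : 'rV[F]_n) :
  apply (tensor A) (ket y) x = \prod_(i < n) apply (A i) (ket (y 0 i)) (x 0 i).
Proof.
have E (T : finType) (B : op T) (u v : T) : apply B (ket u) v = B v u.
  rewrite ffunE (bigD1 u) //= big1 => [|w wu].
    by rewrite ffunE eqxx mulr1 addr0.
  by rewrite ffunE (negbTE wu) mulr0.
by rewrite E; apply: eq_bigr => i _; rewrite E.
Qed.

(* The space spanned by the rows of [G] with index at least [k]. *)
Definition X_stab (m n : nat) (G : 'M[F]_(m, n)) (k : nat) : {set 'rV[F]_n} :=
  [set g : 'rV[F]_n | (g <= \sum_(a < m | (k <= a)%N) <<row a G>>)%MS].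

Definition logical_state (m n : nat) (G : 'M[F]_(m, n)) (k : nat)
    (k_le_m : (k <= m)%N) (u : 'rV[F]_k) : state 'rV[F]_n :=
  \sum_(g in X_stab G k)
    ket (\sum_(a < k) u 0 a *: row (widen_ord k_le_m a) G + g).

(* The physical operator [P] acts on the logical basis states as the logical
   operator [L] acts on the kets of [k] qudits. *)
Definition implements (m n : nat) (G : 'M[F]_(m, n)) (k : nat)
    (k_le_m : (k <= m)%N) (P : op 'rV[F]_n) (L : op 'rV[F]_k) : Prop :=
  forall u : 'rV[F]_k,
    apply P (logical_state G k_le_m u) =
    \sum_(w : 'rV[F]_k) L w u *: logical_state G k_le_m w.

End Qudits.

Arguments trsign R {F} x.
Arguments U7 R {F} beta.
Arguments logical_state R {F m n} G {k} k_le_m u.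

(* Main.v *)
(* Raising to the powers 2 and 4 is additive in characteristic 2, so writing
   x^7 = x^4 x^2 x expands the form sum_i Gamma_i x_i^7 at x = v G into a
   triple sum over the rows of G, which the hypothesis collapses to
   sum_(a <= k) tau_a v_a^7.  Every ket in the superposition |u> has
   coordinates v that agree with u on the logical rows, so they all acquire
   the same sign. *)
Require Import Defs.
From mathcomp Require Import all_boot all_order all_algebra all_field.
From mathcomp Require Import reals complex ring.

Set Implicit Arguments.
Unset Strict Implicit.
Unset Printing Implicit Defensive.

Import GRing.Theory.
Local Open Scope ring_scope.

Lemma tr8D (F : finFieldType) (F8 : #|F| = 8%N) (x y : F) :
  tr8 (x + y) = tr8 x + tr8 y.
Proof.
have pF : 2%N \in [pchar F] by apply: (@card_finPcharP F 2%N 3%N).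
rewrite /tr8 -[4%N]/(2 * 2)%N !exprM -!(pFrobenius_autE pF) !rmorphD.
by rewrite [in RHS]addrACA (addrACA x).
Qed.

(** Traces lie in [{0, 1}], where addition in characteristic 2 is exclusive or of the bits
    [tr8 _ == 1]; the four cases are checked directly. *)
Lemma trsignD (R : realType) (F : finFieldType) (F8 : #|F| = 8%N) (x y : F) :
  trsign R (x + y) = trsign R x * trsign R y.
Proof.
have pF : 2%N \in [pchar F] by apply: (@card_finPcharP F 2%N 3%N).
have one1 : 1 + 1 = 0 :> F by apply: (pcharf0 pF).
rewrite /trsign (tr8D F8) -signr_addb; congr (_ ^+ nat_of_bool _).
have [/eqP-> | /eqP->] := orP (tr8_01 x F8);
  have [/eqP-> | /eqP->] := orP (tr8_01 y F8);
  by rewrite ?one1 ?addr0 ?add0r ?eqxx // ?(eq_sym 0) oner_eq0.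
Qed.

Lemma trsign_sum (R : realType) (F : finFieldType) (F8 : #|F| = 8%N)
    (I : finType) (f : I -> F) :
  trsign R (\sum_i f i) = \prod_i trsign R (f i).
Proof.
apply: (big_morph (trsign R) (trsignD R F8)).
by rewrite /trsign /tr8 !expr0n /= !addr0 eq_sym oner_eq0.
Qed.

Lemma apply_sum (R : realType) (T I : finType) (A : op R T) (P : pred I)
    (f : I -> state R T) :
  apply A (\sum_(i | P i) f i) = \sum_(i | P i) apply A (f i).
Proof.
apply/ffunP => x; rewrite ffunE sum_ffunE; under [RHS]eq_bigr do rewrite ffunE.
by rewrite exchange_big; apply: eq_bigr => y _; rewrite sum_ffunE mulr_sumr.
Qed.

(** Off the diagonal, a coordinate where [x] and [y] differ contributes a zero factor; on it, the
    signs multiply into the sign of the sum. *)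
Lemma tensor_U7E (R : realType) (F : finFieldType) (F8 : #|F| = 8%N) (n : nat)
    (b : 'I_n -> F) (x y : 'rV[F]_n) :
  tensor (fun i => U7 R (b i)) x y =
  if x == y then trsign R (\sum_i b i * y 0 i ^+ 7) else 0.
Proof.
rewrite /tensor /U7; case: eqP => [-> | /eqP neq_xy].
  by rewrite (trsign_sum R F8); apply: eq_bigr => i _; rewrite eqxx.
have [i xyi] : exists i, x 0 i != y 0 i.
  apply/existsP; apply: contraNT neq_xy; rewrite negb_exists.
  by move/forallP => eq_xy; apply/eqP/rowP => i; apply/eqP/negbNE/eq_xy.
by rewrite (bigD1 i) //= (negbTE xyi) mul0r.
Qed.

Lemma tensor_U7_ket (R : realType) (F : finFieldType) (F8 : #|F| = 8%N)
    (n : nat) (b : 'I_n -> F) (x : 'rV[F]_n) :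
  apply (tensor (fun i => U7 R (b i))) (ket R x) =
  trsign R (\sum_i b i * x 0 i ^+ 7) *: ket R x.
Proof.
apply/ffunP => z; rewrite !ffunE (bigD1 x) //= big1 => [|y yx].
  rewrite addr0 !ffunE eqxx mulr1 (tensor_U7E R F8).
  by case: (z == x); rewrite /GRing.scale /= ?mulr1 ?mulr0.
by rewrite ffunE (negbTE yx) mulr0.
Qed.

(** Lets families indexed by the [k] logical rows be padded with zeros to all [m] rows, the form in
    which [tau] enters the hypothesis on [G]. *)
Lemma big_ord_insub (V : nmodType) (k m : nat) (k_le_m : (k <= m)%N)
    (f : 'I_k -> 'I_m -> V) :
  \sum_(a < m) (if insub (val a) is Some j then f j a else 0) =
  \sum_(j < k) f j (widen_ord k_le_m j).
Proof.
rewrite (bigID (fun a : 'I_m => (a < k)%N)) /= [X in _ + X]big1 ?addr0.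
  by rewrite (big_ord_narrow k_le_m); apply: eq_bigr => j _; rewrite /= valK.
by move=> a /negbTE ak; rewrite insubF.
Qed.

(** The weights [t] cover all [m] rows, so logical and stabilizer rows are treated alike; the latter
    will have weight 0. *)
Lemma septic_form_mulmx (F : finFieldType) (F8 : #|F| = 8%N) (m n : nat)
    (G : 'M[F]_(m, n)) (Gamma : 'rV[F]_n) (t : 'I_m -> F)
    (GammaP : forall a b c : 'I_m,
       \sum_(i < n) Gamma 0 i * G a i ^+ 4 * G b i ^+ 2 * G c i =
       if (a == b) && (b == c) then t a else 0)
    (v : 'rV[F]_m) :
  \sum_(i < n) Gamma 0 i * (v *m G) 0 i ^+ 7 = \sum_(a < m) t a * v 0 a ^+ 7.
Proof.
have pF : 2%N \in [pchar F] by apply: (@card_finPcharP F 2%N 3%N).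
have sum2 (f : 'I_m -> F) : (\sum_a f a) ^+ 2 = \sum_a f a ^+ 2.
  by rewrite -(pFrobenius_autE pF) rmorph_sum.
have sum4 (f : 'I_m -> F) : (\sum_a f a) ^+ 4 = \sum_a f a ^+ 4.
  rewrite -[4%N]/(2 * 2)%N exprM !sum2.
  by apply: eq_bigr => a _; rewrite exprM.
transitivity (\sum_a \sum_b \sum_c v 0 a ^+ 4 * v 0 b ^+ 2 * v 0 c *
    \sum_(i < n) Gamma 0 i * G a i ^+ 4 * G b i ^+ 2 * G c i).
  (* The sum over [i] is moved outward past [c], [b] and [a] in turn, so that both sides can be
     compared for each fixed [i]. *)
  under [RHS]eq_bigr do under eq_bigr do
    (under eq_bigr do rewrite mulr_sumr; rewrite exchange_big).
  under [RHS]eq_bigr do rewrite exchange_big.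
  rewrite [RHS]exchange_big; apply: eq_bigr => i _ /=.
  rewrite mxE -[7%N]/(4 + (2 + 1))%N !exprD expr1 sum4 sum2.
  rewrite mulr_suml mulr_sumr; apply: eq_bigr => a _.
  rewrite mulr_suml !mulr_sumr; apply: eq_bigr => b _.
  rewrite !mulr_sumr; apply: eq_bigr => c _.
  by rewrite !exprMn; ring.
(* Only [b = c = a] survives, with coefficient [v_a^4 v_a^2 v_a = v_a^7]. *)
apply: eq_bigr => a _; rewrite (bigD1 a) //= [X in _ + X]big1 ?addr0.
  rewrite (bigD1 a) //= [X in _ + X]big1 ?addr0.
    by rewrite GammaP !eqxx mulrC -exprD -exprSr.
  by move=> c ca; rewrite GammaP eqxx eq_sym (negbTE ca) mulr0.
move=> b ba; apply: big1 => c _.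
by rewrite GammaP eq_sym (negbTE ba) mulr0.
Qed.

Lemma X_stab_coords (F : finFieldType) (m n : nat) (G : 'M[F]_(m, n)) (k : nat)
    (g : 'rV[F]_n) :
  g \in X_stab G k ->
  exists2 v : 'rV[F]_m, g = v *m G & forall a : 'I_m, (a < k)%N -> v 0 a = 0.
Proof.
(* [diag_mx d] projects onto the stabilizer coordinates: it fixes each row of [G] that spans
   [X_stab] and erases the logical ones. *)
pose d : 'rV[F]_m := \row_a (k <= a)%:R.
have sub_dG : (\sum_(a < m | (k <= a)%N) <<row a G>> <= diag_mx d *m G)%MS.
  apply/sumsmx_subP => a ka; rewrite genmxE.
  have -> : row a G = row a (diag_mx d *m G).
    by rewrite row_mul row_diag_mx mxE ka scale1r -rowE.
  exact: row_sub.
rewrite inE => /submx_trans /(_ sub_dG) /submxP[w ->].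
exists (w *m diag_mx d); first by rewrite mulmxA.
by move=> a ak; rewrite mul_mx_diag !mxE leqNgt ak mulr0.
Qed.

Theorem lemma4p2 (R : realType) (F : finFieldType) (F8 : #|F| = 8%N)
    (m n k : nat) (k_gt0 : (0 < k)%N) (k_le_m : (k <= m)%N)
    (G : 'M[F]_(m, n)) (G_full : row_free G)
    (Gamma : 'rV[F]_n) (tau : 'rV[F]_k)
    (GammaP : forall a b c : 'I_m,
       \sum_(i < n) Gamma 0 i * G a i ^+ 4 * G b i ^+ 2 * G c i =
       if (a == b) && (b == c) then
         if insub (val a) is Some j then tau 0 (j : 'I_k) else 0
       else 0)
    (beta : F) :
  implements G k_le_m
    (tensor (fun i : 'I_n => U7 R (beta * Gamma 0 i)))
    (tensor (fun a : 'I_k => U7 R (beta * tau 0 a))) /\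
  (forall u : 'rV[F]_k,
     apply (tensor (fun i : 'I_n => U7 R (beta * Gamma 0 i)))
       (logical_state R G k_le_m u) =
     trsign R (beta * \sum_(a < k) tau 0 a * u 0 a ^+ 7) *:
       logical_state R G k_le_m u).
Proof.
set P := tensor _; set L := tensor _.
have logical_phase (u : 'rV[F]_k) : apply P (logical_state R G k_le_m u) =
    trsign R (beta * \sum_(a < k) tau 0 a * u 0 a ^+ 7) *:
      logical_state R G k_le_m u.
  rewrite /logical_state apply_sum scaler_sumr.
  apply: eq_bigr => _ /X_stab_coords[v -> v0].
  rewrite (tensor_U7_ket R F8); congr (trsign R _ *: _).
  under eq_bigr do rewrite -mulrA.
  rewrite -mulr_sumr; congr (_ * _).
  (* Padding [u] with zeros makes the ket's label the single product [(u' + v) *m G]. *)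
  pose u' : 'rV[F]_m := \row_a (if insub (val a) is Some j then u 0 j else 0).
  have -> : \sum_(a < k) u 0 a *: row (widen_ord k_le_m a) G = u' *m G.
    rewrite mulmx_sum_row -(big_ord_insub k_le_m (fun j a => u 0 j *: row a G)).
    by apply: eq_bigr => a _; rewrite mxE; case: insubP; rewrite ?scale0r.
  rewrite -mulmxDl (septic_form_mulmx F8 GammaP).
  rewrite -(big_ord_insub k_le_m (fun j _ => tau 0 j * u 0 j ^+ 7)).
  apply: eq_bigr => a _; rewrite !mxE.
  (* On a logical row [v] vanishes; on a stabilizer row the weight is 0, whatever [v] is. *)
  by case: insubP => [j ak _ | _]; rewrite ?mul0r // v0 // addr0.
(* [L] is diagonal, so only [w = u] contributes, and its entry there is the phase just found. *)
split=> // u; rewrite logical_phase (bigD1 u) //= [X in _ = _ + X]big1 ?addr0.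
  rewrite /L (tensor_U7E R F8) eqxx mulr_sumr.
  by under [in RHS]eq_bigr do rewrite -mulrA.
by move=> w wu; rewrite /L (tensor_U7E R F8) (negbTE wu) scale0r.
Qed.
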